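(* Let $\mathcal{M} = SO(3)\times\mathbb{R}^3$ be endowed with the product $(R_1,\omega_1)\cdot(R_2,\omega_2) = (R_3,\omega_3)$, where $R_3 = R_1R_2$ and $\omega_3\in\mathbb{R}^3$ is determined by $$\omega_3^\times = \mathbb{P}_{\mathrm a}\left(R_1\omega_2^\times + R_2^\top\omega_1^\times - \tfrac12 [R_1,R_2^\top]\right).$$ Consider the map $\sigma:\mathcal{M}\to\mathbb{R}^3$ defined by $$\sigma(R_{\mathrm e},\omega_{\mathrm e}) = \omega_{\mathrm e} + \operatorname{vex}\left(\mathbb{P}_{\mathrm a}(R_{\mathrm e})\right).$$ Then the set $$\mathcal{D} = \left\{(R_{\mathrm e},\omega_{\mathrm e})\in\mathcal{M} \mid \sigma(R_{\mathrm e},\omega_{\mathrm e}) = 0\right\}$$ is a Lie subgroup of $\mathcal{M}$.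
   Context: $SO(3) = \{R\in\mathbb{R}^{3\times3} \mid RR^\top = I,\ \det R = 1\}$, with $I$ the $3\times 3$ identity matrix. For $\omega = (\omega_1,\omega_2,\omega_3)\in\mathbb{R}^3$, $\omega^\times$ denotes the skew-symmetric matrix $$\omega^\times = \begin{pmatrix} 0 & -\omega_3 & \omega_2\\ \omega_3 & 0 & -\omega_1\\ -\omega_2 & \omega_1 & 0\end{pmatrix},$$ and $\operatorname{vex}:\mathfrak{so}(3)\to\mathbb{R}^3$ is the inverse of the linear isomorphism $\omega\mapsto\omega^\times$, where $\mathfrak{so}(3)$ is the space of real skew-symmetric $3\times3$ matrices. For $A\in\mathbb{R}^{3\times3}$, $\mathbb{P}_{\mathrm a}(A) = \frac12(A-A^\top)$ is its skew-symmetric part. The bracket is $[A,B] = AB-BA$. The paper regards $\mathcal{M} = SO(3)\times\mathbb{R}^3$ with the product $(R_1,\omega_1)\cdot(R_2,\omega_2) = \left(R_1R_2,\ \operatorname{vex}\left(\mathbb{P}_{\mathrm a}\left(R_1\omega_2^\times + R_2^\top\omega_1^\times - \tfrac12 [R_1,R_2^\top]\right)\right)\right)$ as a Lie group.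
   Formalization: The product on M is not associative, so M is not a Lie group; ''Lie subgroup of M'' is read as: D is an embedded submanifold of M containing the identity of M, closed under the product and inverses, and a Lie group (associativity included) under the restricted product. *)

(* Defs.v *)
(* MathComp-Analysis; the real numbers are an arbitrary [R : realType]. *)
From HB Require Import structures.
From mathcomp Require Import all_boot all_order all_algebra.
From mathcomp Require Import all_classical all_reals all_analysis.

Set Implicit Arguments.
Unset Strict Implicit.
Unset Printing Implicit Defensive.

Import Order.TTheory GRing.Theory Num.Theory.
Import numFieldNormedType.Exports.

Local Open Scope classical_set_scope.
Local Open Scope ring_scope.

Section Smooth.
Context {R : realType} {V W : normedModType R}.

(* [Ck n U f]: f is of class C^n on the open set U.  For finite-dimensional V,
   a differentiable f is C^(n+1) iff all its directional derivatives are C^n. *)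
Fixpoint Ck (n : nat) (U : set V) (f : V -> W) : Prop :=
  if n is m.+1 then
    (forall x, U x -> differentiable f x) /\ (forall v, Ck m U ('D_v f))
  else forall x, U x -> {for x, continuous f}.

Definition smooth_on (U : set V) (f : V -> W) : Prop := forall n, Ck n U f.

(* Smoothness along an arbitrary subset S: local smooth extendability to the
   ambient space.  If S is an embedded submanifold of V this is smoothness for
   its manifold structure. *)
Definition smooth_along (S : set V) (f : V -> W) : Prop :=
  forall x, S x -> exists (U : set V) (g : V -> W),
    [/\ open U, U x, smooth_on U g & forall y, U y -> S y -> f y = g y].

End Smooth.

Definition diffeo {R : realType} {V W : normedModType R}
    (U : set V) (U' : set W) (phi : V -> W) : Prop :=
  exists psi : W -> V,
    [/\ open U /\ open U', smooth_on U phi, smooth_on U' psi,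
        (forall x, U x -> U' (phi x) /\ psi (phi x) = x)
      & (forall y, U' y -> U (psi y) /\ phi (psi y) = y)].

(* The ambient Euclidean space containing SO(3) x R^3. *)
Notation ambient R := ('M[R]_3 * 'cV[R]_3)%type.

Section LieSubgroup.
Context {R : realType}.
Implicit Types M D : set (ambient R).

(* Slice charts: around each point of D a diffeomorphism between open subsets of
   the ambient space straightens M to a linear subspace L and D to a linear
   subspace K of L.  Restricted to M, these are slice charts of the embedded
   submanifold M for its subset D.  L and K do not depend on the point, so the
   dimensions are constant. *)
Definition embedded_submanifold M D : Prop :=
  D `<=` M /\
  exists L K : {vspace (ambient R)}, (K <= L)%VS /\
    forall p, D p -> exists (U U' : set (ambient R)) (phi : ambient R -> ambient R),
      [/\ U p, diffeo U U' phi,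
          (forall x, U x -> (M x <-> phi x \in L))
        & (forall x, U x -> (D x <-> phi x \in K))].

(* D is a Lie subgroup of (M, op): it contains the identity of M, is closed
   under op and inversion, is a group for the restricted operation, is an
   embedded submanifold of M, and its group operations are smooth.
   Associativity on D is listed explicitly instead of being inherited from M. *)
Definition lie_subgroup M (op : ambient R -> ambient R -> ambient R) D : Prop :=
  exists (e : ambient R) (inv : ambient R -> ambient R),
  [/\ embedded_submanifold M D,
      [/\ D e,
          (forall p q, D p -> D q -> D (op p q))
        & (forall p, D p -> D (inv p))],
      [/\ (forall p, M p -> op e p = p /\ op p e = p),
          (forall p, D p -> op (inv p) p = e /\ op p (inv p) = e)
        & (forall p q r, D p -> D q -> D r -> op p (op q r) = op (op p q) r)],
      smooth_along (D `*` D)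
        (fun z : ambient R * ambient R => op z.1 z.2)
    & smooth_along D inv].

End LieSubgroup.

Section SO3xR3.
Context {R : realType}.
Implicit Types (A B : 'M[R]_3) (w : 'cV[R]_3) (p q : ambient R).

Definition SO3 : set 'M[R]_3 := [set A | A *m A^T = 1%:M /\ \det A = 1].

(* The coordinates w_1, w_2, w_3 are w 0 0, w 1 0, w 2 0. *)
Definition hat w : 'M[R]_3 :=
  \matrix_(i < 3, j < 3) nth 0 (nth [::]
    [:: [:: 0;           - w 2 0;  w 1 0];
        [:: w 2 0;    0;           - w 0 0];
        [:: - w 1 0;     w 0 0;       0]] i) j.

Definition so3 : set 'M[R]_3 := [set A | A^T = - A].

(* Total function; only meaningful on [so3], where it is inverse to [hat]. *)
Definition vex A : 'cV[R]_3 :=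
  \col_(i < 3) nth 0 [:: A 2 1; A 0 2; A 1 0] i.

Definition Pa A : 'M[R]_3 := 2^-1 *: (A - A^T).

Definition bracket A B : 'M[R]_3 := A *m B - B *m A.

Lemma hat_so3 w : so3 (hat w).
Proof.
apply/matrixP => -[[|[|[|//]]] ?] [[|[|[|//]]] ?]; by rewrite !mxE /= ?opprK ?oppr0.
Qed.

Lemma Pa_so3 A : so3 (Pa A).
Proof. by rewrite /so3 /Pa /= linearZ linearB /= trmxK -scalerN opprB. Qed.

Lemma hatK : cancel hat vex.
Proof.
move=> w; apply/matrixP => -[[|[|[|//]]] ?] j; rewrite !mxE /= (ord1 j);
  by congr (w _ _); apply: val_inj.
Qed.

Lemma vexK A : so3 A -> hat (vex A) = A.
Proof.
move=> /matrixP hA; have E i j : A j i = - A i j by have := hA i j; rewrite !mxE.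
have E0 i : A i i = 0.
  by apply/eqP; rewrite -[_ == 0]/(false || _) -(mulrn_eq0 _ 2) mulr2n {1}E addNr.
apply/matrixP => i j; rewrite !mxE.
move: i j => [[|[|[|//]]] hi] [[|[|[|//]]] hj] /=;
  rewrite -?E; first [by congr (A _ _); apply: val_inj
  | by rewrite -[LHS](E0 (Ordinal hi)); congr (A _ _); apply: val_inj].
Qed.

Definition SO3xR3 : set (ambient R) := [set p | SO3 p.1].

(* This product is not associative on all of SO3xR3 (see SO3xR3_mul_nonassoc). *)
Definition SO3xR3_mul p q : ambient R :=
  (p.1 *m q.1,
   vex (Pa (p.1 *m hat q.2 + q.1^T *m hat p.2 - 2^-1 *: bracket p.1 q.1^T))).

Definition sigma_map p : 'cV[R]_3 := p.2 + vex (Pa p.1).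

Definition sigma_zero_set : set (ambient R) :=
  [set p | SO3xR3 p /\ sigma_map p = 0].

Lemma hat_SO3xR3_mul p q : hat (SO3xR3_mul p q).2 =
  Pa (p.1 *m hat q.2 + q.1^T *m hat p.2 - 2^-1 *: bracket p.1 q.1^T).
Proof. exact/vexK/Pa_so3. Qed.

Lemma SO3xR3_mul_closed p q : SO3xR3 p -> SO3xR3 q -> SO3xR3 (SO3xR3_mul p q).
Proof.
rewrite /SO3xR3 /SO3 /= => -[pT pd] [qT qd]; split; last by rewrite det_mulmx pd qd mulr1.
by rewrite trmx_mul mulmxA -(mulmxA p.1) qT mulmx1.
Qed.

Lemma SO3xR3_mul_nonassoc : exists p q r, [/\ SO3xR3 p, SO3xR3 q, SO3xR3 r
  & SO3xR3_mul p (SO3xR3_mul q r) <> SO3xR3_mul (SO3xR3_mul p q) r].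
Proof.
pose S : 'M[R]_3 := diag_mx (\row_j nth 0 [:: -1; -1; 1] j).
have ST : S^T = S by rewrite tr_diag_mx.
have SS : S *m S = 1%:M.
  apply/matrixP => i j; rewrite mul_diag_mx !mxE.
  by move: i j => [[|[|[|//]]] hi] [[|[|[|//]]] hj]; rewrite /= ?mulr0 ?mulr1n ?mulr0n ?mulrNN ?mulr1 ?mulr0.
have hS : SO3 S.
  split; first by rewrite ST.
  by rewrite det_diag !big_ord_recl big_ord0 !mxE /= !mulr1 mulrNN mulr1.
have h0 : hat 0 = 0.
  by apply/matrixP => -[[|[|[|//]]] hi] [[|[|[|//]]] hj]; rewrite !mxE /= ?mxE ?oppr0.
have Sw w : w 2 0 = 0 -> SO3xR3_mul (S, 0) (S, w) = (1%:M, 0).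
  move=> w2; rewrite /SO3xR3_mul /= ST SS h0 mulmx0 addr0 /bracket subrr scaler0 subr0.
  congr pair; apply/matrixP => i j; rewrite (ord1 j) mul_diag_mx.
  by case: i => -[|[|[|//]]] hi; rewrite !mxE /= ?w2 ?mulN1r ?mul1r ?opprK ?addNr ?subrr ?oppr0 ?subr0 ?addr0 ?mulr0.
have mul1 w : SO3xR3_mul (1%:M, 0) (S, w) = (S, w).
  rewrite /SO3xR3_mul /= h0 mulmx0 addr0 /bracket !mul1mx mulmx1 subrr scaler0 subr0.
  congr pair; rewrite -[RHS]hatK; congr vex.
  rewrite /Pa (hat_so3 w) opprK.
  have -> : hat w + hat w = 2 *: hat w by rewrite scaler_nat mulr2n.
  by rewrite scalerA mulVf ?scale1r.
have mulr_id : SO3xR3_mul (S, 0) (1%:M, 0) = (S, 0).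
  rewrite /SO3xR3_mul /= h0 !mulmx0 addr0 /bracket trmx1 !mul1mx !mulmx1 subrr scaler0 subr0.
  by congr pair; rewrite /Pa trmx0 subr0 scaler0 -h0 hatK.
pose u : 'cV[R]_3 := \col_i (i == 0)%:R.
exists (S, 0), (S, 0), (S, u); split => //.
rewrite !Sw ?mxE // mulr_id mul1 => -[] /matrixP/(_ 0 0).
by rewrite !mxE /= => /esym/eqP; rewrite oner_eq0.
Qed.

End SO3xR3.

(* Main.v *)
(* On D one has hat w = - Pa R, and then the product is (R1 R2, - vex (Pa (R1 R2))):
   D is the graph of R |-> - vex (Pa R) over SO(3), the product of M restricts to
   the one transported from SO(3), and associativity holds on D although it fails
   on M.  Near (R0, w0) the Cayley transform in the form
   A |-> (R0^T A + 1)^-1 - 1/2 straightens SO(3) to the skew-symmetric matrices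
   (A is orthogonal iff Y := (R0^T A + 1)^-1 satisfies Y + Y^T = 1), and taking
   sigma as second coordinate straightens D to the skew matrices times 0. *)
Require Import Defs.
From HB Require Import structures.
From mathcomp Require Import all_boot all_order all_algebra.
From mathcomp Require Import all_classical all_reals all_analysis.
From mathcomp Require Import ring.

Set Implicit Arguments.
Unset Strict Implicit.
Unset Printing Implicit Defensive.

Import Order.TTheory GRing.Theory Num.Theory.
Import numFieldNormedType.Exports.

Local Open Scope classical_set_scope.
Local Open Scope ring_scope.

(** * Calculus of C^n functions *)

Section SmoothCalculus.
Context {R : realType} {V : normedModType R}.
Implicit Types (W : normedModType R) (U : set V).

(** The first-order expansion of [f] at [x] is also one for [g], and uniqueness of the differential
    then identifies ['d g x] with ['d f x]. *)
Lemma near_eq_differentiable W (f g : V -> W) (x : V) :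
  (\near x, f x = g x) -> differentiable f x -> differentiable g x.
Proof.
move=> fg /diff_locallyP [dfc dfE].
have dgE : g \o shift x = cst (g x) + 'd f x +o_ 0 id.
  apply/eqaddoP => e e0; move/eqaddoE/eqaddoP: dfE => /(_ e e0).
  have fgx : f x = g x by exact: nbhs_singleton fg.
  move: fg; rewrite (near_shift 0) subr0; apply: filterS2 => h /= fgh.
  by rewrite !fctE /= -fgh -fgx.
by apply/diff_locallyP; rewrite (diff_unique dfc dgE).
Qed.

Lemma CkW W n U (f : V -> W) : Ck n.+1 U f -> Ck n U f.
Proof.
elim: n f => [|n IH] f [fd fD]; first by move=> x /fd/differentiable_continuous.
by split=> [//|v]; exact: IH (fD v).
Qed.

(** Openness of [U] turns equality on [U] into equality near each point, which passes to
    derivatives. This lets a derivative be replaced by a formula valid only on [U]. *)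
Lemma eq_Ck W n U (f g : V -> W) : open U -> (forall x, U x -> f x = g x) ->
  Ck n U f -> Ck n U g.
Proof.
move=> oU; elim: n f g => [|n IH] f g fg.
  move=> fc x Ux; rewrite /prop_for /continuous_at -fg //.
  apply: cvg_trans (fc x Ux); apply: near_eq_cvg.
  by apply: filterS (open_nbhs_nbhs (conj oU Ux)) => y /fg.
have nfg x : U x -> \near x, f x = g x.
  by move=> Ux; apply: filterS (open_nbhs_nbhs (conj oU Ux)).
move=> [fd fD]; split=> [x Ux|v].
  exact: near_eq_differentiable (nfg x Ux) (fd x Ux).
by apply: IH (fD v) => x Ux; exact: near_eq_derive (nfg x Ux).
Qed.

Lemma Ck_cst W n U (a : W) : Ck n U (cst a).
Proof.
elim: n a => [|n IH] a; first by move=> x _; exact: cst_continuous.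
split=> [x _|v]; first exact: differentiable_cst.
by rewrite (_ : 'D_v (cst a) = cst 0) //; apply/funext => x; exact: derive_cst.
Qed.

Lemma CkD W n U (f g : V -> W) : open U -> Ck n U f -> Ck n U g ->
  Ck n U (fun x => f x + g x).
Proof.
move=> oU; elim: n f g => [|n IH] f g.
  by move=> fc gc x Ux; apply: continuousD; [exact: fc | exact: gc].
move=> [fd fD] [gd gD]; split=> [x Ux|v].
  by apply: differentiableD; [exact: fd | exact: gd].
apply: eq_Ck (IH _ _ (fD v) (gD v)) => // x Ux.
by rewrite -deriveD //; apply: diff_derivable; [exact: fd | exact: gd].
Qed.

(** Leibniz's rule keeps one factor undifferentiated; [CkW] lowers that factor to order [n], so that
    the induction hypothesis applies. *)
Lemma CkM n U (f g : V -> R) : open U -> Ck n U f -> Ck n U g ->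
  Ck n U (fun x => f x * g x).
Proof.
move=> oU; elim: n f g => [|n IH] f g.
  by move=> fc gc x Ux; apply: continuousM; [exact: fc | exact: gc].
move=> fS gS; have [[fd fD] [gd gD]] := (fS, gS); split=> [x Ux|v].
  by apply: differentiableM; [exact: fd | exact: gd].
apply: (eq_Ck oU _ (CkD oU (IH _ _ (CkW fS) (gD v)) (IH _ _ (CkW gS) (fD v)))).
move=> x Ux.
by rewrite -[LHS]deriveM //; apply: diff_derivable; [exact: fd | exact: gd].
Qed.

(** The derivative is [- f^-2 * 'D_v f], so the induction runs with [f] fixed: the hypothesis at
    order [n] is used for [f^-1] itself. *)
Lemma CkV n U (f : V -> R) : open U -> (forall x, U x -> f x != 0) ->
  Ck n U f -> Ck n U (fun x => (f x)^-1).
Proof.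
move=> oU f0; elim: n => [|n IH].
  by move=> fc x Ux; apply: continuousV; [exact: f0 | exact: fc].
move=> fS; have [fd fD] := fS; split=> [x Ux|v].
  by apply: differentiableV; [exact: fd | exact: f0].
have fVC := IH (CkW fS).
have fV2 := CkM oU (Ck_cst n U (-1 : R)) (CkM oU fVC fVC).
apply: (eq_Ck oU _ (CkM oU fV2 (fD v))) => x Ux.
rewrite deriveV ?f0 //; last exact/diff_derivable/fd.
by rewrite /cst mulN1r -expr2 exprVn.
Qed.

Lemma CkZl W n U (f : V -> R) (w : W) : open U -> Ck n U f ->
  Ck n U (fun x => f x *: w).
Proof.
move=> oU; elim: n f => [|n IH] f.
  by move=> fc x Ux; apply: continuousZr_tmp; exact: fc.
move=> [fd fD]; split=> [x Ux|v]; first exact/differentiableZl/fd.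
apply: eq_Ck (IH _ (fD v)) => // x Ux; have fdx := fd x Ux.
by rewrite !deriveE ?diffZl //; exact: differentiableZl.
Qed.

Lemma Ck_pair W W' n U (f : V -> W) (g : V -> W') : open U ->
  Ck n U f -> Ck n U g -> Ck n U (fun x => (f x, g x)).
Proof.
move=> oU; elim: n f g => [|n IH] f g.
  by move=> fc gc x Ux; apply: cvg_pair; [exact: fc | exact: gc].
move=> [fd fD] [gd gD]; split=> [x Ux|v].
  by apply: differentiable_pair; [exact: fd | exact: gd].
apply: eq_Ck (IH _ _ (fD v) (gD v)) => // x Ux.
have [fdx gdx] := (fd x Ux, gd x Ux).
by rewrite !deriveE ?diff_pair//; exact: differentiable_pair.
Qed.

(** Each directional derivative is the constant [f v], so no induction on [n] is involved. *)
Lemma Ck_linear W n U (f : V -> W) : linear f -> continuous f -> Ck n U f.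
Proof.
move=> flin fc; pose F : {linear V -> W} :=
  HB.pack f (GRing.isLinear.Build R V W _ f flin).
case: n => [|n]; first by move=> x _; exact: fc.
split=> [x _|v]; first exact: (@linear_differentiable _ _ _ F).
rewrite (_ : 'D_v f = cst (f v)); first exact: Ck_cst.
apply/funext => x; rewrite deriveE; last exact: (@linear_differentiable _ _ _ F).
by rewrite (@diff_lin _ _ _ F).
Qed.

Lemma Ck_sum W n U I (r : seq I) (f : I -> V -> W) : open U ->
  (forall i, Ck n U (f i)) -> Ck n U (fun x => \sum_(i <- r) f i x).
Proof.
move=> oU fC; elim: r => [|i r IH].
  by under eq_fun do rewrite big_nil; exact: Ck_cst.
by under eq_fun do rewrite big_cons; exact: CkD.
Qed.

Lemma Ck_prod n U I (r : seq I) (f : I -> V -> R) : open U ->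
  (forall i, Ck n U (f i)) -> Ck n U (fun x => \prod_(i <- r) f i x).
Proof.
move=> oU fC; elim: r => [|i r IH].
  by under eq_fun do rewrite big_nil; exact: Ck_cst.
by under eq_fun do rewrite big_cons; exact: CkM.
Qed.

End SmoothCalculus.

(** * Smoothness of matrix-valued maps, entry by entry *)

Section SmoothMatrix.
Context {R : realType} {V : normedModType R} (U : set V) (oU : open U).

(* Entrywise, so that matrices of arbitrary size, including empty minors, which
   carry no normedModType structure, are covered. *)
Definition smooth_mx p q (F : V -> 'M[R]_(p, q)) :=
  forall i j, smooth_on U (fun x => F x i j).

Lemma smooth_mx_on p q (F : V -> 'M[R]_(p.+1, q.+1)) :
  smooth_mx F -> smooth_on U F.
Proof.
move=> FS n; rewrite (_ : F = fun x => \sum_i \sum_j F x i j *: delta_mx i j).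
  by apply: Ck_sum => // i; apply: Ck_sum => // j; apply: CkZl => //; exact: FS.
by apply/funext => x; exact: matrix_sum_delta.
Qed.

Lemma smooth_mx_cst p q (A : 'M[R]_(p, q)) : smooth_mx (fun=> A).
Proof. by move=> i j n; exact: Ck_cst. Qed.

Lemma smooth_mx_continuous_linear p q (f : V -> 'M[R]_(p.+1, q.+1)) :
  linear f -> continuous f -> smooth_mx f.
Proof.
move=> fl fc i j n; apply: Ck_linear; first by move=> a u v; rewrite fl !mxE.
by move=> x; exact: (continuous_comp (fc x) (@coord_continuous _ _ _ i j (f x))).
Qed.

Lemma smooth_mxD p q (F G : V -> 'M[R]_(p, q)) :
  smooth_mx F -> smooth_mx G -> smooth_mx (fun x => F x + G x).
Proof.
move=> FS GS i j n; under eq_fun do rewrite mxE.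
by apply: CkD => //; [exact: FS | exact: GS].
Qed.

Lemma smooth_mxM p q r (F : V -> 'M[R]_(p, q)) (G : V -> 'M[R]_(q, r)) :
  smooth_mx F -> smooth_mx G -> smooth_mx (fun x => F x *m G x).
Proof.
move=> FS GS i j n; under eq_fun do rewrite mxE.
by apply: Ck_sum => // k; apply: CkM => //; [exact: FS | exact: GS].
Qed.

(** Each entry of [L (F x)] is a finite combination of the entries of [F x] with the constant
    coefficients [L (delta_mx a b) i j]. *)
Lemma smooth_mx_linear p q p' q' (L : 'M[R]_(p, q) -> 'M[R]_(p', q'))
    (F : V -> 'M[R]_(p, q)) :
  linear L -> smooth_mx F -> smooth_mx (fun x => L (F x)).
Proof.
move=> Llin FS i j n.
pose L' : {linear _ -> _} := HB.pack L (GRing.isLinear.Build R _ _ _ L Llin).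
rewrite (_ : (fun x => _) =
  fun x => \sum_a \sum_b F x a b * L (delta_mx a b) i j).
  apply: Ck_sum => // a; apply: Ck_sum => // b; apply: CkM => //.
    exact: FS.
  exact: Ck_cst.
apply/funext => x; rewrite [in LHS](matrix_sum_delta (F x)).
rewrite -[L]/(L' : _ -> _) linear_sum summxE; apply: eq_bigr => a _.
by rewrite linear_sum summxE; apply: eq_bigr => b _; rewrite linearZ mxE.
Qed.

Lemma smooth_det p (F : V -> 'M[R]_p) :
  smooth_mx F -> smooth_on U (fun x => \det (F x)).
Proof.
move=> FS n; apply: Ck_sum => // s; apply: CkM => //; first exact: Ck_cst.
by apply: Ck_prod => // i; exact: FS.
Qed.

(** Cramer's rule: where the determinant is nonzero, an entry of the inverse is a cofactor divided
    by the determinant. *)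
Lemma smooth_invmx p (F : V -> 'M[R]_p) : (forall x, U x -> \det (F x) != 0) ->
  smooth_mx F -> smooth_mx (fun x => invmx (F x)).
Proof.
move=> F0 FS i j n.
apply: (@eq_Ck _ _ _ _ _ (fun x => (\det (F x))^-1 *
    ((-1) ^+ (j + i) * \det (row' j (col' i (F x)))))) => //.
  by move=> x /F0 d0; rewrite /invmx unitmxE unitfE d0 !mxE.
apply: CkM => //; first by apply: CkV => //; exact: smooth_det.
apply: CkM => //; first exact: Ck_cst.
apply: smooth_det => a b m; under eq_fun do rewrite !mxE; exact: FS.
Qed.

End SmoothMatrix.

(** * The group D *)

Section LinearMaps.
Context {R : realType}.

Lemma hat_linear : linear (@hat R).
Proof.
move=> a u v; apply/matrixP => -[[|[|[|//]]] ?] [[|[|[|//]]] ?];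
  by rewrite !mxE /= ?mxE ?mulr0 ?addr0 ?opprD ?mulrN.
Qed.

Lemma vex_linear : linear (@vex R).
Proof.
by move=> a A B; apply/matrixP => -[[|[|[|//]]] ?] j; rewrite !mxE /= ?mxE.
Qed.

Lemma Pa_linear : linear (@Pa R).
Proof.
by move=> a A B; apply/matrixP => i j; rewrite !mxE; ring.
Qed.

Lemma trmx_linear p q : linear (@trmx R p q).
Proof. exact: linearP. Qed.

Lemma opp_linear p q : linear (fun A : 'M[R]_(p, q) => - A).
Proof. exact: linearP. Qed.

Lemma scale_linear p q (k : R) : linear (fun A : 'M[R]_(p, q) => k *: A).
Proof. exact: linearP. Qed.

End LinearMaps.

(** * Product, identity and inverse on D *)

Section SO3xR3_group.
Context {R : realType}.
Implicit Types (A B : 'M[R]_3) (p q r : ambient R).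

Lemma hat_inj : injective (@hat R).
Proof. exact: can_inj (@hatK R). Qed.

Lemma hat_vex_Pa A : hat (vex (Pa A)) = Pa A.
Proof. exact/vexK/Pa_so3. Qed.

Lemma sigma_map0P p : sigma_map p = 0 <-> p.2 = - vex (Pa p.1).
Proof.
by rewrite /sigma_map; split=> [/eqP|->]; rewrite ?addNr// addr_eq0 => /eqP.
Qed.

Lemma hatN (w : 'cV[R]_3) : hat (- w) = - hat w.
Proof.
apply/matrixP => -[[|[|[|//]]] ?] [[|[|[|//]]] ?]; by rewrite !mxE /= ?mxE ?oppr0.
Qed.

Lemma PaK A : A^T = - A -> Pa A = A.
Proof.
by move=> AT; rewrite /Pa AT; apply/matrixP => i j; rewrite !mxE; field.
Qed.

Lemma Pa_tr A : Pa A^T = - Pa A.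
Proof. by rewrite /Pa trmxK -scalerN opprB. Qed.

Lemma SO3_tr A : SO3 A -> SO3 A^T.
Proof.
by move=> [AA dA]; split; rewrite ?det_tr // trmxK; exact: mulmx1C.
Qed.

(** After substituting [hat w = - Pa R] for both factors, the bracket term cancels the mixed
    products [R1 R2^T] and [R2^T R1]. What remains is [- Pa (R1 R2)], which is skew and hence fixed
    by the outer [Pa]. *)
Lemma sigma_zero_mul p q : sigma_zero_set p -> sigma_zero_set q ->
  SO3xR3_mul p q = (p.1 *m q.1, - vex (Pa (p.1 *m q.1))).
Proof.
move=> [_ /sigma_map0P p2] [_ /sigma_map0P q2]; congr pair; apply: hat_inj.
rewrite hat_SO3xR3_mul p2 q2 !hatN !hat_vex_Pa -[RHS]PaK; last first.
  by rewrite linearN /= Pa_so3 opprK.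
congr Pa; rewrite /Pa /bracket !mulmxN -!scalemxAr trmx_mul !mulmxBr.
(* With the four products made opaque, the identity is linear in their entries. *)
move: (p.1 *m q.1) (p.1 *m q.1^T) (q.1^T *m p.1) (q.1^T *m p.1^T) => a b c d.
by apply/matrixP => i j; rewrite !mxE; ring.
Qed.

Lemma sigma_zero_mul_closed p q : sigma_zero_set p -> sigma_zero_set q ->
  sigma_zero_set (SO3xR3_mul p q).
Proof.
move=> Dp Dq; split; first exact: SO3xR3_mul_closed Dp.1 Dq.1.
by rewrite sigma_zero_mul //; apply/sigma_map0P.
Qed.

Lemma hat0 : hat (0 : 'cV[R]_3) = 0.
Proof.
apply/matrixP => -[[|[|[|//]]] ?] [[|[|[|//]]] ?]; by rewrite !mxE /= ?mxE ?oppr0.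
Qed.

Lemma SO3xR3_mul1l p : SO3xR3_mul (1%:M, 0) p = p.
Proof.
case: p => A w; congr pair; rewrite /= ?mul1mx //.
rewrite hat0 mulmx0 addr0 /bracket mulmx1 mul1mx subrr scaler0 subr0.
by rewrite PaK ?hatK // hat_so3.
Qed.

Lemma SO3xR3_mul1r p : SO3xR3_mul p (1%:M, 0) = p.
Proof.
case: p => A w; congr pair; rewrite /= ?mulmx1 //.
rewrite hat0 mulmx0 add0r /bracket trmx1 mulmx1 !mul1mx subrr scaler0 subr0.
by rewrite PaK ?hatK // hat_so3.
Qed.

(** The sign is forced on D: the point of D over [R^T] has second coordinate
    [- vex (Pa R^T) = vex (Pa R) = - w]. *)
Definition SO3xR3_inv p : ambient R := (p.1^T, - p.2).

Lemma sigma_zero_inv_closed p : sigma_zero_set p -> sigma_zero_set (SO3xR3_inv p).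
Proof.
move=> [Mp /sigma_map0P p2]; split; first exact: SO3_tr.
apply/sigma_map0P; rewrite /= p2; apply: hat_inj.
by rewrite !hatN !hat_vex_Pa Pa_tr.
Qed.

(* D is a graph over SO(3), so identities in D can be checked on rotations. *)
Lemma sigma_zero_eq p q : sigma_zero_set p -> sigma_zero_set q -> p.1 = q.1 -> p = q.
Proof.
case: p q => [A v] [B w] [_ /sigma_map0P/= ->] [_ /sigma_map0P/= ->] /= -> //.
Qed.

Lemma sigma_zero1 : sigma_zero_set ((1%:M, 0) : ambient R).
Proof.
split; first by split; rewrite /= ?trmx1 ?mulmx1 ?det1.
apply/sigma_map0P; rewrite /Pa trmx1 subrr scaler0.
by rewrite -hat0 hatK oppr0.
Qed.

End SO3xR3_group.

(** * Smoothness and slice charts *)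

Section SliceCharts.
Context {R : realType}.
Implicit Types (A B : 'M[R]_3) (p q r : ambient R).

Lemma smooth_on_pair {V W W' : normedModType R} (U : set V)
    (f : V -> W) (g : V -> W') : open U ->
  smooth_on U f -> smooth_on U g -> smooth_on U (fun x => (f x, g x)).
Proof. by move=> oU fS gS n; exact: Ck_pair. Qed.

Lemma smooth_mx_pair {V : normedModType R} (U : set V) (F : V -> 'M[R]_3)
    (w : V -> 'cV[R]_3) : open U ->
  smooth_mx U F -> smooth_mx U w -> smooth_on U (fun x => (F x, w x) : ambient R).
Proof. by move=> oU FS wS; apply: smooth_on_pair => //; exact: smooth_mx_on. Qed.

Lemma smooth_mx_fst {V : normedModType R} (f : V -> ambient R) (U : set V) :
  linear f -> continuous f -> smooth_mx U (fun x => (f x).1).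
Proof.
move=> fl fc; apply: smooth_mx_continuous_linear => [a u v|x]; first by rewrite fl.
exact: (continuous_comp (fc x) cvg_fst).
Qed.

Lemma smooth_mx_snd {V : normedModType R} (f : V -> ambient R) (U : set V) :
  linear f -> continuous f -> smooth_mx U (fun x => (f x).2).
Proof.
move=> fl fc; apply: smooth_mx_continuous_linear => [a u v|x]; first by rewrite fl.
exact: (continuous_comp (fc x) cvg_snd).
Qed.

(** The product formula is polynomial in the entries on the whole ambient space, so it serves as its
    own extension in [smooth_along]. *)
Lemma smooth_SO3xR3_mul :
  smooth_on setT (fun z : ambient R * ambient R => SO3xR3_mul z.1 z.2).
Proof.
have oT : open [set: ambient R * ambient R] := openT.
have [p1 p2] : smooth_mx setT (fun z : ambient R * ambient R => z.1.1)
    /\ smooth_mx setT (fun z : ambient R * ambient R => z.1.2).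
  by split; [apply: smooth_mx_fst|apply: smooth_mx_snd] => // x; exact: cvg_fst.
have [q1 q2] : smooth_mx setT (fun z : ambient R * ambient R => z.2.1)
    /\ smooth_mx setT (fun z : ambient R * ambient R => z.2.2).
  by split; [apply: smooth_mx_fst|apply: smooth_mx_snd] => // x; exact: cvg_snd.
have q1T := smooth_mx_linear oT (@trmx_linear R _ _) q1.
apply: smooth_mx_pair => //; first exact: smooth_mxM.
apply: (smooth_mx_linear oT (@vex_linear R)).
apply: (smooth_mx_linear oT (@Pa_linear R)).
apply: smooth_mxD => //.
  by apply: smooth_mxD => //; apply: smooth_mxM => //;
    exact: (smooth_mx_linear oT (@hat_linear R)).
apply: (smooth_mx_linear oT (@opp_linear R _ _)).
apply: (smooth_mx_linear oT (@scale_linear R _ _ _)).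
apply: smooth_mxD => //; first exact: smooth_mxM.
by apply: (smooth_mx_linear oT (@opp_linear R _ _)); exact: smooth_mxM.
Qed.

Lemma smooth_mx_ambient (U : set (ambient R)) :
  smooth_mx U (fun p : ambient R => p.1) /\ smooth_mx U (fun p : ambient R => p.2).
Proof.
by split; [apply: (@smooth_mx_fst _ id) | apply: (@smooth_mx_snd _ id)] => // x;
  exact: cvg_id.
Qed.

Lemma smooth_SO3xR3_inv : smooth_on setT (@SO3xR3_inv R).
Proof.
have oT : open [set: ambient R] := openT.
have [p1 p2] := @smooth_mx_ambient setT.
apply: smooth_mx_pair => //.
  exact: (smooth_mx_linear oT (@trmx_linear R _ _)).
exact: (smooth_mx_linear oT (@opp_linear R _ _)).
Qed.

Lemma smooth_sigma_map U : open U -> smooth_mx U (@sigma_map R).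
Proof.
move=> oU; have [p1 p2] := smooth_mx_ambient U.
apply: smooth_mxD => //; apply: (smooth_mx_linear oU (@vex_linear R)).
exact: (smooth_mx_linear oU (@Pa_linear R)).
Qed.

Lemma smooth_mx_affine (U : set (ambient R)) A B : open U ->
  smooth_mx U (fun p : ambient R => A *m p.1 + B).
Proof.
move=> oU; have [p1 _] := smooth_mx_ambient U.
apply: smooth_mxD => //; last exact: smooth_mx_cst.
by apply: smooth_mxM => //; exact: smooth_mx_cst.
Qed.

(** * Invertibility domains and the Cayley transform *)

Lemma open_det_neq0 (F : ambient R -> 'M[R]_3) :
  smooth_mx setT F -> open [set p | \det (F p) != 0].
Proof.
move=> FS; rewrite -[[set _ | _]]/((fun p => \det (F p)) @^-1` [set x | x != 0]).
apply: open_comp; last exact: open_neq.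
(* Order 0 of smoothness is continuity. *)
by move=> x _; exact: (smooth_det openT FS 0%N).
Qed.

(** Multiplying [N^-1 + N^-T] by [N] on the left and [N^T] on the right gives [N^T + N]; both
    factors are invertible and can be cancelled. *)
Lemma invmx_add_tr n (N : 'M[R]_n) : N \in unitmx ->
  (invmx N + (invmx N)^T == 1%:M) = (N *m N^T == N + N^T).
Proof.
move=> uN; have uNT : N^T \in unitmx by rewrite unitmx_tr.
have -> : N *m N^T = N *m (1%:M) *m N^T by rewrite mulmx1.
have -> : N + N^T = N *m (invmx N + (invmx N)^T) *m N^T.
  rewrite mulmxDr mulmxDl mulmxV // mul1mx -mulmxA -trmx_mul mulmxV //.
  by rewrite trmx1 mulmx1 addrC.
apply/eqP/eqP => [->//|].
by move=> /(can_inj (mulmxK uNT))/(can_inj (mulKmx uN)) ->.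
Qed.

(** With [B = R0^T A] and [N = B + 1], the difference [N N^T - (N + N^T)] equals [B B^T - 1], so
    [invmx_add_tr] reduces the condition on [N^-1] to orthogonality of [B], equivalently of [A]. *)
Lemma SO3_cayley R0 A : SO3 R0 -> \det (R0^T *m A + 1%:M) != 0 ->
  SO3 A <-> invmx (R0^T *m A + 1%:M) + (invmx (R0^T *m A + 1%:M))^T = 1%:M.
Proof.
move=> [RR dR] dN; set B := R0^T *m A in dN *; set N := B + 1%:M in dN *.
have uN : N \in unitmx by rewrite unitmxE unitfE.
have RtR := mulmx1C RR.
have BB : B *m B^T = 1%:M <-> A *m A^T = 1%:M.
  have -> : B *m B^T = R0^T *m (A *m A^T) *m R0 by rewrite trmx_mul trmxK !mulmxA.
  split=> [E|->]; last by rewrite mulmx1.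
  have : R0 *m (R0^T *m (A *m A^T) *m R0) *m R0^T = R0 *m 1%:M *m R0^T by rewrite E.
  by rewrite mulmx1 RR !mulmxA RR mul1mx -mulmxA RR mulmx1.
have NB : (N *m N^T == N + N^T) = (B *m B^T == 1%:M).
  rewrite -[LHS]subr_eq0 -[RHS]subr_eq0; congr (_ == 0).
  rewrite /N linearD /= trmx1 mulmxDl !mulmxDr !mulmx1 !mul1mx.
  by move: (B *m B^T) B^T => C BT; apply/matrixP => i j; rewrite !mxE; ring.
split=> [[/BB/eqP AA _]|].
  by apply/eqP; rewrite invmx_add_tr // NB.
move=> /eqP; rewrite invmx_add_tr // NB => /eqP B1; split; first exact/BB.
(* Since det N <> 0, taking determinants gives det B = 1. *)
have : N = B *m N^T by rewrite /N linearD /= trmx1 mulmxDr B1 mulmx1 addrC.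
move=> /(congr1 determinant); rewrite det_mulmx det_tr.
by rewrite -[LHS]mul1r => /(mulIf dN); rewrite det_mulmx det_tr dR mul1r => <-.
Qed.

(** * Linear models and the Cayley slice chart *)

Definition skew_gap p := p.1 + p.1^T.

Lemma skew_gap_linear : linear skew_gap.
Proof.
by move=> a p q; apply/matrixP => i j; rewrite /skew_gap /= !mxE; ring.
Qed.

HB.instance Definition _ :=
  GRing.isLinear.Build R (ambient R) 'M[R]_3 _ skew_gap skew_gap_linear.

(** This is [so(3) x R^3], the linear model of M; taking it as a kernel makes it a [{vspace}] with a
    computable membership test. *)
Definition skew_space : {vspace ambient R} := lker (linfun skew_gap).

Definition skew_space0 : {vspace ambient R} :=
  (skew_space :&: lker (linfun (snd : ambient R -> 'cV[R]_3)))%VS.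

Lemma mem_skew_space p : (p \in skew_space) = (p.1 + p.1^T == 0).
Proof. by rewrite memv_ker lfunE. Qed.

Lemma mem_skew_space0 p :
  (p \in skew_space0) = (p.1 + p.1^T == 0) && (p.2 == 0).
Proof. by rewrite memv_cap mem_skew_space memv_ker lfunE. Qed.

(** Subtracting this matrix turns the affine condition [Y + Y^T = 1] into skew-symmetry of
    [Y - 1/2]. *)
Definition half_mx : 'M[R]_3 := (2^-1)%:M.

(** On [cayley_dom R0] the first coordinate is [1/2 (1 + B)^-1 (1 - B)] with [B = R0^T R]: half the
    classical Cayley transform, centred so that [R0] goes to 0. *)
Definition cayley_chart R0 p : ambient R :=
  (invmx (R0^T *m p.1 + 1%:M) - half_mx, sigma_map p).

(** Obtained by solving [R0^T A + 1 = (X + 1/2)^-1] for [A], then recovering the second coordinate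
    from the value of [sigma_map]. *)
Definition cayley_chart_inv R0 p : ambient R :=
  let A := R0 *m (invmx (p.1 + half_mx) - 1%:M) in (A, p.2 - vex (Pa A)).

Definition cayley_dom R0 : set (ambient R) :=
  [set p | \det (R0^T *m p.1 + 1%:M) != 0].

Definition cayley_img : set (ambient R) :=
  [set p | \det (p.1 + half_mx) != 0].

Lemma cayley_dom_open R0 : open (cayley_dom R0).
Proof. by apply: open_det_neq0; apply: smooth_mx_affine; exact: openT. Qed.

Lemma cayley_img_open : open cayley_img.
Proof.
apply: open_det_neq0; rewrite (_ : (fun p => _) = (fun p => 1%:M *m p.1 + half_mx)).
  by apply: smooth_mx_affine; exact: openT.
by apply/funext => p; rewrite mul1mx.
Qed.

Lemma cayley_diffeo R0 : SO3 R0 ->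
  diffeo (cayley_dom R0) cayley_img (cayley_chart R0).
Proof.
move=> [RR _]; have RtR := mulmx1C RR.
have oU : open (cayley_dom R0) by exact: cayley_dom_open.
have oU' := cayley_img_open.
exists (cayley_chart_inv R0); split=> //.
- apply: smooth_mx_pair => //; last exact: smooth_sigma_map.
  apply: smooth_mxD => //; last exact: smooth_mx_cst.
  by apply: smooth_invmx => //; exact: smooth_mx_affine oU.
- have [p1 p2] := smooth_mx_ambient cayley_img.
  have AS : smooth_mx cayley_img (fun p => R0 *m (invmx (p.1 + half_mx) - 1%:M)).
    apply: smooth_mxM => //; first exact: smooth_mx_cst.
    apply: smooth_mxD => //; last exact: smooth_mx_cst.
    by apply: smooth_invmx => //; apply: smooth_mxD => //; exact: smooth_mx_cst.
  apply: smooth_mx_pair => //; apply: smooth_mxD => //.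
  apply: (smooth_mx_linear oU' (@opp_linear R _ _)).
  apply: (smooth_mx_linear oU' (@vex_linear R)).
  exact: (smooth_mx_linear oU' (@Pa_linear R)).
(* Adding [half_mx] back leaves an inverse matrix, whose determinant is nonzero along with the
   original one; the other composition is symmetric. *)
- move=> p Up; rewrite /cayley_img /cayley_chart_inv /= subrK invmxK addrK.
  rewrite mulmxA RR mul1mx; split.
    by rewrite det_inv invr_eq0.
  by rewrite /sigma_map addrK; case: p {Up}.
- move=> p Up; rewrite /cayley_dom /cayley_chart /cayley_chart_inv /=.
  rewrite mulmxA RtR mul1mx subrK invmxK addrK; split.
    by rewrite det_inv invr_eq0.
  by rewrite /sigma_map /= subrK; case: p {Up}.
Qed.

Lemma half_mx_tr : half_mx + half_mx^T = 1%:M.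
Proof.
apply/matrixP => i j; rewrite !mxE eq_sym; case: eqP => _ /=; last by rewrite addr0.
by field.
Qed.

Lemma cayley_skew R0 p : SO3 R0 -> cayley_dom R0 p ->
  SO3xR3 p <-> cayley_chart R0 p \in skew_space.
Proof.
move=> R0S Up; rewrite mem_skew_space /= linearB /= addrACA -opprD half_mx_tr.
by rewrite subr_eq0 /SO3xR3 /= (SO3_cayley R0S Up); split=> [->|/eqP].
Qed.

Lemma sigma_zero_embedded : embedded_submanifold SO3xR3 (@sigma_zero_set R).
Proof.
split; first by move=> p [].
exists skew_space, skew_space0; split; first exact: capvSl.
move=> p [Mp _]; exists (cayley_dom p.1), cayley_img, (cayley_chart p.1).
split; [| exact: cayley_diffeo | by move=> q; exact: cayley_skew |].
  (* At the base point the matrix is twice the identity, with determinant [2 ^ 3], so [p] lies in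
     the domain of its own chart. *)
  rewrite /cayley_dom /= (mulmx1C Mp.1) -[1%:M + 1%:M]/((1 : 'M[R]_3) + 1) -mulr2n.
  by rewrite -scaler_nat detZ det1 mulr1 expf_neq0 // pnatr_eq0.
move=> q Uq; rewrite mem_skew_space0 -mem_skew_space.
split=> [[Mq /= s0]|/andP[Lq /eqP s0]].
  by apply/andP; split; [exact/(cayley_skew Mp Uq) | exact/eqP].
by split=> //; exact/(cayley_skew Mp Uq).
Qed.

End SliceCharts.

Theorem proposition1 (R : realType) :
  @lie_subgroup R SO3xR3 SO3xR3_mul sigma_zero_set.
Proof.
exists (1%:M, 0), (@SO3xR3_inv R); split.
- exact: sigma_zero_embedded.
- split; [exact: sigma_zero1 | exact: sigma_zero_mul_closed
         | exact: sigma_zero_inv_closed].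
- split=> [p _|p Dp|p q r Dp Dq Dr].
  + by rewrite SO3xR3_mul1l SO3xR3_mul1r.
  + have Dip := sigma_zero_inv_closed Dp; have [[pp _] _] := Dp.
    split; apply: sigma_zero_eq; rewrite /= ?(mulmx1C pp) //;
      by [exact: sigma_zero1 | exact: sigma_zero_mul_closed].
  (* Both bracketings lie in D, so associativity of matrix multiplication on the rotations
     suffices. *)
  + apply: sigma_zero_eq; rewrite /= ?mulmxA //.
      by do 2?apply: sigma_zero_mul_closed.
    by do 2?apply: sigma_zero_mul_closed.
- move=> z _; exists setT, (fun z => SO3xR3_mul z.1 z.2); split=> //.
    exact: openT.
  exact: smooth_SO3xR3_mul.
- move=> z _; exists setT, (@SO3xR3_inv R); split=> //.
    exact: openT.
  exact: smooth_SO3xR3_inv.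
Qed.
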